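(* Let $d,s,k\geq 1$ be integers, let $\gamma_1,\dots,\gamma_s\in\mathbb{C}$ be distinct and nonzero, let $j:\{1,\dots,d\}\to\{1,\dots,s\}$ be an assignment of indices to clusters, and let $f(\gamma)= y_1^k\gamma^k+y_1^{k-1}\gamma^{k-1}+\cdots+y_1^1\gamma-1$ be a polynomial with complex coefficients $y_1^1,\dots,y_1^k$ (superscripts on $y_1$ are indices, not powers) such that $f(\gamma_j)=0$ for all $1\leq j\leq s$. For $\epsilon_1,\dots,\epsilon_d\in\mathbb{C}$ put $\lambda_i=\gamma_{j(i)}+\epsilon_i$ ($1\leq i\leq d$) and $\epsilon=\max(|\epsilon_1|,|\epsilon_2|,\dots,|\epsilon_d|)$. Then $$\|(f(\lambda_1),f(\lambda_2),\dots,f(\lambda_d))^\top\|_2=\mathcal{O}(\epsilon)\qquad(\epsilon\to 0).$$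
   Context: The $\mathcal{O}$-notation is understood with $d,s,k$, the centers $\gamma_j$, the assignment $j(\cdot)$ and the polynomial $f$ fixed: there exist constants $C>0$ and $\epsilon_*>0$, depending only on these data, such that for all $(\epsilon_1,\dots,\epsilon_d)\in\mathbb{C}^d$ with $\epsilon\leq\epsilon_*$ the left-hand side is at most $C\epsilon$. *)

(* Defs.v *)
From mathcomp Require Import all_boot all_order all_algebra.
From mathcomp Require Import reals complex.

Set Implicit Arguments.
Unset Strict Implicit.
Unset Printing Implicit Defensive.

Import Order.TTheory GRing.Theory Num.Theory.
Local Open Scope ring_scope.
Local Open Scope complex_scope.

(* The generic norm `|z| of R[i] takes its values in R[i]; cmod is the modulus
   with values in R, so that real constants and bounds live in R. *)
Notation cmod := ComplexField.Normc.normc.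

Definition l2norm (R : realType) (d : nat) (v : 'cV[R[i]]_d) : R :=
  Num.sqrt (\sum_(i < d) cmod (v i 0) ^+ 2).

(* Moduli are nonnegative, so for 0 < d the default value 0 of the iterated
   maximum plays no role. *)
Definition maxmod (R : realType) (d : nat) (e : 'I_d -> R[i]) : R :=
  \big[Num.max/0]_(i < d) cmod (e i).

(* y_k X^k + ... + y_1 X - 1, where the coefficient y_(i+1) of X^(i+1) is
   stored as y i, for i : 'I_k. *)
Definition fpoly (R : realType) (k : nat) (y : 'I_k -> R[i]) : {poly R[i]} :=
  (\sum_(i < k) y i *: 'X^(i.+1)) - 1.

(* Main.v *)
(* Since [f] vanishes at [gamma_j], the factor theorem writes it as
   [q (X - gamma_j)], hence [f (gamma_j + e) = q (gamma_j + e) e], and [q] is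
   bounded on the unit disk around [gamma_j]; so [epsstar = 1] works. *)
Require Import Defs.
From mathcomp Require Import all_boot all_order all_algebra.
From mathcomp Require Import reals complex.

Import Order.TTheory GRing.Theory Num.Theory.
Local Open Scope ring_scope.
Local Open Scope complex_scope.

Lemma cmod_ge0 {R : realType} (x : R[i]) : 0 <= cmod x.
Proof. by case: x => u v; apply: sqrtr_ge0. Qed.

(** Induction along Horner's scheme: if [M] bounds [p] on the closed unit disk around [a], then
    [M * (cmod a + 1) + cmod c] bounds [p * 'X + c] there, because [cmod (a + e) <= cmod a + 1]. *)
Lemma poly_bounded_near {R : realType} (p : {poly R[i]}) (a : R[i]) :
  exists M : R, forall e : R[i], cmod e <= 1 -> cmod p.[a + e] <= M.
Proof.
elim/poly_ind: p => [|p c [M pM]].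
  by exists 0 => e _; rewrite horner0 ComplexField.Normc.normc0.
exists (M * (cmod a + 1) + cmod c) => e e1.
rewrite hornerMXaddC; apply: le_trans (le_normcD _ _) _.
rewrite lerD2r ComplexField.Normc.normcM ler_pM ?cmod_ge0 ?pM //.
by apply: le_trans (le_normcD _ _) _; rewrite lerD2l.
Qed.

Lemma root_poly_lipschitz {R : realType} (p : {poly R[i]}) (a : R[i]) :
  p.[a] = 0 ->
  exists M : R, forall e : R[i], cmod e <= 1 -> cmod p.[a + e] <= M * cmod e.
Proof.
move=> /rootP/factor_theorem[q ->].
have [M qM] := poly_bounded_near q a; exists M => e e1.
rewrite hornerM hornerXsubC addrAC subrr add0r ComplexField.Normc.normcM.
by rewrite ler_wpM2r ?cmod_ge0 ?qM.
Qed.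

Theorem theorem3 (R : realType) (d s k : nat)
    (hd : (1 <= d)%N) (hs : (1 <= s)%N) (hk : (1 <= k)%N)
    (gamma : 'I_s -> R[i]) (gamma_inj : injective gamma)
    (gamma_neq0 : forall l : 'I_s, gamma l != 0)
    (j : 'I_d -> 'I_s) (y : 'I_k -> R[i])
    (f_gamma : forall l : 'I_s, (fpoly y).[gamma l] = 0) :
  exists C epsstar : R, 0 < C /\ 0 < epsstar /\
    forall eps : 'I_d -> R[i], maxmod eps <= epsstar ->
      l2norm (\col_(i < d) (fpoly y).[gamma (j i) + eps i]) <= C * maxmod eps.
Proof.
have [M fM] := fin_all_exists (fun l => root_poly_lipschitz _ _ (f_gamma l)).
(* The square root comes from bounding entry [i] by [M (j i) * maxmod eps]; adding 1 keeps the
   constant positive even if every [M (j i)] is 0. *)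
exists (Num.sqrt (\sum_(i < d) M (j i) ^+ 2) + 1), 1.
split; first by rewrite ltr_wpDl ?sqrtr_ge0.
split=> // eps eps1.
have m_ge0 : 0 <= maxmod eps by exact: bigmax_ge_id.
have eps_m i : cmod (eps i) <= maxmod eps.
  exact: (le_bigmax _ (fun i => cmod (eps i))).
apply: (@le_trans _ _ (Num.sqrt (\sum_(i < d) M (j i) ^+ 2) * maxmod eps)).
  (* Once [maxmod eps] is moved under the root as a square, the two sums can be compared term by
     term. *)
  rewrite -[X in _ * X]ger0_norm // -sqrtr_sqr -sqrtrM; last first.
    by apply: sumr_ge0 => i _; exact: sqr_ge0.
  rewrite ler_wsqrtr // mulr_suml ler_sum // => i _; rewrite mxE.
  have fi := fM (j i) (eps i) (le_trans (eps_m i) eps1).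
  apply: (@le_trans _ _ ((M (j i) * cmod (eps i)) ^+ 2)).
    (* The sign of [M (j i)] is unknown, but its product with [cmod (eps i)] bounds a modulus and is
       thus nonnegative, so squaring is monotone here. *)
    by rewrite lerXn2r ?nnegrE ?(le_trans (cmod_ge0 _) fi) ?cmod_ge0.
  by rewrite exprMn ler_wpM2l ?sqr_ge0 // lerXn2r ?nnegrE ?cmod_ge0.
by rewrite ler_wpM2r // lerDl.
Qed.
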